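(* Let $V$ be a real vector space with $\dim V=3$, let $\{e_1,e_2,e_3\}$ be a basis of $V$, and let $\mathrm{O}(3)$ act on $V\cong\mathbb{R}^3$ via this basis, inducing an action on $W^*$. Let $M\in (W^* )^{\mathrm{O}(3)}$ be an $\mathrm{O}(3)$-invariant element. Then $M\in\mathcal{C}_W^*$ if and only if $M$ satisfies the elastic positivity bounds, i.e. $M(\alpha\otimes\beta,\alpha\otimes\beta)\ge0$ for all $\alpha,\beta\in V^*$.
   Context: $W:=\{S\in \mathrm{Sym}^2(\mathrm{Sym}^2V^* )\oplus\mathrm{Sym}^2(\Lambda^2V^* ):\tau S=S\}\subset (V^* )^{\otimes 4}$, where $(\tau S)(v_1,v_2,v_3,v_4)=S(v_1,v_4,v_3,v_2)$. Each $S\in W$ is regarded as a symmetric bilinear form on $V\otimes V$ via $S(a\otimes b,c\otimes d)=S(a,b,c,d)$, and $\mathcal{C}_W:=\{S\in W:S\ge0\}$ is the cone of positive semi-definite elements. The dual space $W^*$ is identified, via the natural pairing of $V^{\otimes 4}$ with $(V^* )^{\otimes 4}$, with the space of tensors $M\in V^{\otimes 4}$ having the same symmetries, i.e. $M\in\mathrm{Sym}^2(\mathrm{Sym}^2V)\oplus\mathrm{Sym}^2(\Lambda^2V)$ and $M$ is invariant under exchanging its second and fourth tensor factors. Such an $M$ is also viewed as a symmetric bilinear form on $V^*\otimes V^*$. The dual cone is $\mathcal{C}_W^*:=\{M\in W^*: M(S)\ge0\ \text{for all } S\in\mathcal{C}_W\}$, where $M(S)$ is the natural pairing. For a group $G$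 acting on $W^*$, $(W^* )^G$ denotes the subspace of $G$-invariant elements. *)

(* Defs.v *)
From HB Require Import structures.
From mathcomp Require Import all_boot all_order all_algebra.
From mathcomp Require Import reals.

Set Implicit Arguments.
Unset Strict Implicit.
Unset Printing Implicit Defensive.

Import Order.TTheory GRing.Theory Num.Theory.
Local Open Scope ring_scope.

(* V is finite-dimensional throughout. (V^* )^{(x)4} is the space of
   quadrilinear forms on V and, through V = V^**, V^{(x)4} is the space of
   quadrilinear forms on V^*; both are instances of [tensor4], at V and at
   [dual V]. A tensor v1 (x) v2 (x) v3 (x) v4 of vectors is thus the form
   (a, b, c, d) |-> a(v1) b(v2) c(v3) d(v4); see [pure4]. *)

Definition dual (R : realType) (V : vectType R) : vectType R := 'Hom(V, R^o).

Section Tensors.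
Variables (R : realType) (U : vectType R).

Definition tensor4 := U -> U -> U -> U -> R.

Definition quadrilinear (F : tensor4) : Prop :=
  [/\ forall b c d, scalar (fun a => F a b c d),
      forall a c d, scalar (fun b => F a b c d),
      forall a b d, scalar (fun c => F a b c d) &
      forall a b c, scalar (fun d => F a b c d)].

Definition in_Sym2_Sym2 (F : tensor4) : Prop :=
  [/\ quadrilinear F,
      forall a b c d, F b a c d = F a b c d,
      forall a b c d, F a b d c = F a b c d &
      forall a b c d, F c d a b = F a b c d].

Definition in_Sym2_Lambda2 (F : tensor4) : Prop :=
  [/\ quadrilinear F,
      forall a b c d, F b a c d = - F a b c d,
      forall a b c d, F a b d c = - F a b c d &
      forall a b c d, F c d a b = F a b c d].

Definition tau (F : tensor4) : tensor4 := fun a b c d => F a d c b.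

Definition in_W (F : tensor4) : Prop :=
  (exists F1 F2, [/\ in_Sym2_Sym2 F1, in_Sym2_Lambda2 F2 &
     forall a b c d, F a b c d = F1 a b c d + F2 a b c d])
  /\ forall a b c d, tau F a b c d = F a b c d.

(* F(t, t) >= 0 for every t in U (x) U, written as a finite sum
   t = \sum_i a_i (x) b_i of simple tensors. *)
Definition psd (F : tensor4) : Prop :=
  forall (m : nat) (a b : 'I_m -> U),
    0 <= \sum_(i < m) \sum_(j < m) F (a i) (b i) (a j) (b j).

Definition in_CW (F : tensor4) : Prop := in_W F /\ psd F.

End Tensors.

Section Duality.
Variables (R : realType) (V : vectType R).

Definition in_Wdual (M : tensor4 (dual V)) : Prop := in_W M.

Definition dual_coord n (e : n.-tuple V) (i : 'I_n) : dual V :=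
  linfun (coord e i : V -> R^o).

Definition pairing_in n (e : n.-tuple V) (M : tensor4 (dual V))
    (S : tensor4 V) : R :=
  \sum_(i < n) \sum_(j < n) \sum_(k < n) \sum_(l < n)
    M (dual_coord e i) (dual_coord e j) (dual_coord e k) (dual_coord e l)
    * S e`_i e`_j e`_k e`_l.

Definition pure4 (v1 v2 v3 v4 : V) : tensor4 (dual V) :=
  fun a b c d => a v1 * b v2 * c v3 * d v4.

(* The natural pairing of V^{(x)4} with (V^* )^{(x)4}, computed in some basis
   of V; [pairing_pure4] shows that it is evaluation on simple tensors and
   [pairingE] that any basis gives the same value. *)
Definition pairing (M : tensor4 (dual V)) (S : tensor4 V) : R :=
  pairing_in (vbasis {:V}) M S.

Definition in_CW_dual (M : tensor4 (dual V)) : Prop :=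
  in_Wdual M /\ forall S : tensor4 V, in_CW S -> 0 <= pairing M S.

Definition elastic_positivity (M : tensor4 (dual V)) : Prop :=
  forall alpha beta : dual V, 0 <= M alpha beta alpha beta.

Definition mx_act n (e : n.-tuple V) (A : 'M[R]_n) (v : V) : V :=
  \sum_(j < n) coord e j v *: \sum_(i < n) A i j *: e`_i.

Definition endo_of_mx n (e : n.-tuple V) (A : 'M[R]_n) : 'End(V) :=
  linfun (mx_act e A).

(* g acts on V^{(x)4} as g (x) g (x) g (x) g. *)
Definition push (g : 'End(V)) (M : tensor4 (dual V)) : tensor4 (dual V) :=
  fun a b c d => M (a \o g)%VF (b \o g)%VF (c \o g)%VF (d \o g)%VF.

Definition orthogonal_mx n (A : 'M[R]_n) : Prop := A *m A^T = 1%:M.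

Definition in_Wdual_O n (e : n.-tuple V) (M : tensor4 (dual V)) : Prop :=
  in_Wdual M /\
  forall A : 'M[R]_n, orthogonal_mx A ->
    forall a b c d, push (endo_of_mx e A) M a b c d = M a b c d.

Lemma mx_act_linear n (e : n.-tuple V) (A : 'M[R]_n) : linear (mx_act e A).
Proof.
move=> x u v; rewrite /mx_act scaler_sumr -big_split /=.
by apply: eq_bigr => j _; rewrite linearP scalerDl scalerA.
Qed.

HB.instance Definition _ n (e : n.-tuple V) (A : 'M[R]_n) :=
  GRing.isSemilinear.Build R V V _ (mx_act e A)
    (GRing.semilinear_linear (mx_act_linear e A)).

Lemma endo_of_mxE n (e : n.-tuple V) (A : 'M[R]_n) v :
  endo_of_mx e A v = mx_act e A v.
Proof. by rewrite lfunE. Qed.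

Lemma endo_of_mx_basis n (e : n.-tuple V) (A : 'M[R]_n) (j : 'I_n) :
  basis_of {:V} e -> endo_of_mx e A e`_j = \sum_(i < n) A i j *: e`_i.
Proof.
move=> /basis_free fe; rewrite endo_of_mxE /mx_act (bigD1 j) //= coord_free //.
rewrite eqxx scale1r [X in _ + X]big1 ?addr0 // => k nkj.
by rewrite coord_free // eq_sym (negPf nkj) scale0r.
Qed.

Lemma push_pure4 (g : 'End(V)) v1 v2 v3 v4 a b c d :
  push g (pure4 v1 v2 v3 v4) a b c d = pure4 (g v1) (g v2) (g v3) (g v4) a b c d.
Proof. by rewrite /push /pure4 !comp_lfunE. Qed.

Lemma dual_coordE n (e : n.-tuple V) i v : dual_coord e i v = coord e i v.
Proof. by rewrite lfunE. Qed.

Lemma scalar_sum (U : lmodType R) (f : U -> R) : scalar f ->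
  forall n (x : 'I_n -> R) (u : 'I_n -> U),
  f (\sum_i x i *: u i) = \sum_i x i * f (u i).
Proof.
move=> lf n x u; have f0 : f 0 = 0.
  by have := lf (-1) 0 0; rewrite scaler0 add0r mulN1r addNr.
elim/big_rec2: _ => [//|i y z _ <-]; exact: lf.
Qed.

Section OneSlot.
Variables (n p : nat) (e : n.-tuple V) (f : p.-tuple V).
Hypotheses (he : basis_of {:V} e) (hf : basis_of {:V} f).

Lemma slot_indep (B : dual V -> V -> R) :
  (forall v, scalar (fun a => B a v)) -> (forall a, scalar (B a)) ->
  \sum_(i < n) B (dual_coord e i) e`_i = \sum_(i < p) B (dual_coord f i) f`_i.
Proof.
move=> Bl Br.
under eq_bigr => i _.
  rewrite [X in B _ X](coord_basis hf) ?memvf // scalar_sum //.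
  over.
rewrite exchange_big /=; apply: eq_bigr => q _.
rewrite -(scalar_sum (Bl f`_q) (fun i => coord f q e`_i)).
congr (B _ _); apply/lfunP => v.
rewrite sum_lfunE dual_coordE [in RHS](coord_basis he (memvf v)) linear_sum /=.
apply: eq_bigr => i _.
by rewrite scale_lfunE dual_coordE linearZ /= mulrC.
Qed.

End OneSlot.

Lemma scalarMr (U : lmodType R) (f : U -> R) (y : R) :
  scalar f -> scalar (fun u => f u * y).
Proof. by move=> lf x u v; rewrite lf mulrDl mulrA. Qed.

Lemma scalarMl (U : lmodType R) (f : U -> R) (y : R) :
  scalar f -> scalar (fun u => y * f u).
Proof. by move=> lf x u v; rewrite lf mulrDr mulrCA. Qed.

Lemma pairing_in_indep n p (e : n.-tuple V) (f : p.-tuple V) M S :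
  basis_of {:V} e -> basis_of {:V} f -> quadrilinear M -> quadrilinear S ->
  pairing_in e M S = pairing_in f M S.
Proof.
move=> he hf [M1 M2 M3 M4] [S1 S2 S3 S4]; rewrite /pairing_in.
transitivity (\sum_(i < n) \sum_(j < n) \sum_(k < n) \sum_(l < p)
    M (dual_coord e i) (dual_coord e j) (dual_coord e k) (dual_coord f l)
    * S e`_i e`_j e`_k f`_l).
  do 3 apply: eq_bigr => ? _.
  by apply: (slot_indep he hf
    (B := fun a v => M _ _ _ a * S _ _ _ v)) => ?;
    [apply: scalarMr | apply: scalarMl].
transitivity (\sum_(i < n) \sum_(j < n) \sum_(k < p) \sum_(l < p)
    M (dual_coord e i) (dual_coord e j) (dual_coord f k) (dual_coord f l)
    * S e`_i e`_j f`_k f`_l).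
  do 2 apply: eq_bigr => ? _.
  rewrite exchange_big [RHS]exchange_big; apply: eq_bigr => l _ /=.
  by apply: (slot_indep he hf
    (B := fun a v => M _ _ a _ * S _ _ v _)) => ?;
    [apply: scalarMr | apply: scalarMl].
transitivity (\sum_(i < n) \sum_(j < p) \sum_(k < p) \sum_(l < p)
    M (dual_coord e i) (dual_coord f j) (dual_coord f k) (dual_coord f l)
    * S e`_i f`_j f`_k f`_l).
  apply: eq_bigr => ? _.
  rewrite exchange_big [RHS]exchange_big; apply: eq_bigr => k _ /=.
  rewrite exchange_big [RHS]exchange_big; apply: eq_bigr => l _ /=.
  by apply: (slot_indep he hf
    (B := fun a v => M _ a _ _ * S _ v _ _)) => ?;
    [apply: scalarMr | apply: scalarMl].
rewrite exchange_big [RHS]exchange_big; apply: eq_bigr => j _ /=.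
rewrite exchange_big [RHS]exchange_big; apply: eq_bigr => k _ /=.
rewrite exchange_big [RHS]exchange_big; apply: eq_bigr => l _ /=.
by apply: (slot_indep he hf
  (B := fun a v => M a _ _ _ * S v _ _ _)) => ?;
  [apply: scalarMr | apply: scalarMl].
Qed.

Lemma pairingE n (e : n.-tuple V) M S :
  basis_of {:V} e -> quadrilinear M -> quadrilinear S ->
  pairing M S = pairing_in e M S.
Proof. by move=> he; apply: pairing_in_indep => //; apply: vbasisP. Qed.

Lemma pairing_pure4 v1 v2 v3 v4 S : quadrilinear S ->
  pairing (pure4 v1 v2 v3 v4) S = S v1 v2 v3 v4.
Proof.
move=> [S1 S2 S3 S4]; have e := coord_basis (vbasisP {:V}) (memvf _).
rewrite /pairing /pairing_in /pure4 [in RHS](e v1).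
rewrite (scalar_sum (S1 _ _ _)); apply: eq_bigr => i _.
rewrite [in RHS](e v2) (scalar_sum (S2 _ _ _)) mulr_sumr; apply: eq_bigr => j _.
rewrite [in RHS](e v3) (scalar_sum (S3 _ _ _)) !mulr_sumr; apply: eq_bigr => k _.
rewrite [in RHS](e v4) (scalar_sum (S4 _ _ _)) !mulr_sumr; apply: eq_bigr => l _.
by rewrite !dual_coordE !mulrA.
Qed.

End Duality.

(* Main.v *)
Require Import Defs.
From mathcomp Require Import all_boot all_order all_algebra.
From mathcomp Require Import reals.
From mathcomp Require Import ring lra.

Import GRing.Theory Num.Theory.
Local Open Scope ring_scope.

(* Write [m i j k l] for the coefficients of an invariant [M]. Sign changes of
   the coordinates kill every coefficient in which some index occurs an odd
   number of times, and a reflection with entries 3/5 and 4/5 in a coordinate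
   plane gives [m i i i i = nu] and [2 m i i j j + m i j i j = nu] for a
   constant [nu]. For [S] in W this turns the pairing into
     [M(S) = nu S(id, id) + \sum_(i < j) m i j i j S(w_ij, w_ij)],
   where [id] is the sum of the [e_i (x) e_i] and
   [w_ij = e_i (x) e_j - e_j (x) e_i]. Elastic positivity at the coordinate
   covectors says [nu >= 0] and [m i j i j >= 0]. Conversely, the elastic bound
   at [a], [b] is, up to a factor 2, the pairing of [M] with the sum of
   squares [(a (x) b)^2 + (b (x) a)^2], which lies in the cone. *)

(** * Symmetries of the elements of W, and positivity on an antisymmetrised pair *)

Section Tensors.
Context {R : realType} {U : vectType R}.
Implicit Types F S : tensor4 U.

Lemma in_W_quadrilinear F : in_W F -> quadrilinear F.
Proof.
move=> [[F1 [F2 [[[A1 A2 A3 A4] _ _ _] [[B1 B2 B3 B4] _ _ _] EF]]] _].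
by split=> [b c d|a c d|a b d|a b c] x u v; rewrite !EF;
  rewrite ?(A1, B1) ?(A2, B2) ?(A3, B3) ?(A4, B4); ring.
Qed.

Lemma in_W_exchange F a b c d : in_W F -> F c d a b = F a b c d.
Proof.
by move=> [[F1 [F2 [[_ _ _ h1] [_ _ _ h2] EF]]] _]; rewrite !EF h1 h2.
Qed.

Lemma in_W_flip F a b c d : in_W F -> F b a d c = F a b c d.
Proof.
move=> [[F1 [F2 [[_ h1 h2 _] [_ h3 h4 _] EF]]] _].
by rewrite !EF h1 h2 h3 h4 opprK.
Qed.

Lemma in_W_tau F a b c d : in_W F -> F a d c b = F a b c d.
Proof. by case=> _; apply. Qed.

(** Split [F] into its symmetric and antisymmetric parts in the first two slots. Flipping both pairs
    at once fixes [F], so each part has the same type of symmetry in the last two slots. *)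
Lemma in_WI F : quadrilinear F ->
  (forall a b c d, F c d a b = F a b c d) ->
  (forall a b c d, F b a d c = F a b c d) ->
  (forall a b c d, F a d c b = F a b c d) -> in_W F.
Proof.
move=> [F1 F2 F3 F4] ex fl ta; split=> //.
exists (fun a b c d => 2^-1 * (F a b c d + F b a c d)).
exists (fun a b c d => 2^-1 * (F a b c d - F b a c d)).
split; last by move=> a b c d; field.
- split.
  + by split=> [b c d|a c d|a b d|a b c] x u v;
      rewrite ?F1 ?F2 ?F3 ?F4 /=; ring.
  + by move=> a b c d; ring.
  + by move=> a b c d; rewrite -(fl a b d c) -(fl b a d c) addrC.
  + by move=> a b c d; rewrite (ex a b c d) (ex a b d c) (fl b a c d).
- split.
  + by split=> [b c d|a c d|a b d|a b c] x u v;
      rewrite ?F1 ?F2 ?F3 ?F4 /=; ring.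
  + by move=> a b c d; ring.
  + by move=> a b c d; rewrite -(fl a b d c) -(fl b a d c); ring.
  + by move=> a b c d; rewrite (ex a b c d) (ex a b d c) (fl b a c d).
Qed.

Lemma scalarZ (f : U -> R) x u : scalar f -> f (x *: u) = x * f u.
Proof.
move=> lf; have f0 : f 0 = 0.
  by have := lf (-1) 0 0; rewrite scaler0 add0r mulN1r addNr.
by have := lf x u 0; rewrite f0 !addr0.
Qed.

Lemma quadrilinearZ F x y z t a b c d : quadrilinear F ->
  F (x *: a) (y *: b) (z *: c) (t *: d) = x * y * z * t * F a b c d.
Proof.
move=> [F1 F2 F3 F4].
by rewrite (scalarZ _ _ _ (F1 _ _ _)) (scalarZ _ _ _ (F2 _ _ _))
  (scalarZ _ _ _ (F3 _ _ _)) (scalarZ _ _ _ (F4 _ _ _)) !mulrA.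
Qed.

Lemma psd_antisym S a b : quadrilinear S -> psd S ->
  0 <= S a b a b + S b a b a - S a b b a - S b a a b.
Proof.
(* The two simple tensors [a (x) b] and [(-b) (x) a] add up to the antisymmetrised tensor. *)
move=> qS /(_ 2%N (fun i => if i == 0 then a else (-1) *: b)
               (fun i => if i == 0 then b else a)).
rewrite !big_ord_recl !big_ord0 /= !addr0.
case: qS => S1 _ S3 _.
rewrite !(scalarZ _ _ _ (S1 _ _ _)) !(scalarZ _ _ _ (S3 _ _ _)).
by lra.
Qed.

End Tensors.

(** * Pairing with products of covectors; the elastic bounds as a necessary condition *)

Section Pairing.
Context {R : realType} {V : vectType R}.
Implicit Types (M : tensor4 (dual V)) (S : tensor4 V).

Lemma dual_coord_sum n (e : n.-tuple V) (phi : dual V) : basis_of {:V} e ->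
  phi = \sum_(i < n) phi e`_i *: dual_coord e i.
Proof.
move=> he; apply/lfunP => v; rewrite sum_lfunE.
rewrite [in LHS](coord_basis he (memvf v)) linear_sum /=.
by apply: eq_bigr => i _; rewrite scale_lfunE dual_coordE linearZ; exact: mulrC.
Qed.

Lemma pairing_covectors M (a b c d : dual V) : quadrilinear M ->
  pairing M (fun v1 v2 v3 v4 => a v1 * b v2 * c v3 * d v4) = M a b c d.
Proof.
move=> [M1 M2 M3 M4]; have he phi := dual_coord_sum _ _ phi (vbasisP {:V}).
rewrite /pairing /pairing_in.
rewrite [in RHS](he a) (scalar_sum (M1 _ _ _)); apply: eq_bigr => i _.
rewrite [in RHS](he b) (scalar_sum (M2 _ _ _)) mulr_sumr; apply: eq_bigr => j _.
rewrite [in RHS](he c) (scalar_sum (M3 _ _ _)) !mulr_sumr; apply: eq_bigr => k _.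
rewrite [in RHS](he d) (scalar_sum (M4 _ _ _)) !mulr_sumr; apply: eq_bigr => l _.
by ring.
Qed.

Lemma pairingD M S1 S2 :
  pairing M (fun a b c d => S1 a b c d + S2 a b c d) =
  pairing M S1 + pairing M S2.
Proof.
rewrite /pairing /pairing_in.
do 4 (rewrite -big_split /=; apply: eq_bigr => ? _).
by rewrite mulrDr.
Qed.

(** The square of [a (x) b] alone is not invariant under flipping both pairs; the flip exchanges the
    two summands here. *)
Lemma in_CW_square (a b : dual V) :
  in_CW (fun v1 v2 v3 v4 =>
           a v1 * b v2 * a v3 * b v4 + b v1 * a v2 * b v3 * a v4).
Proof.
split.
  apply: in_WI.
  - by split=> [v2 v3 v4|v1 v3 v4|v1 v2 v4|v1 v2 v3] x u v;
      rewrite !linearP /=; rewrite /GRing.scale /=; ring.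
  - by move=> v1 v2 v3 v4; ring.
  - by move=> v1 v2 v3 v4; ring.
  - by move=> v1 v2 v3 v4; ring.
move=> m x y.
have -> : \sum_(i < m) \sum_(j < m)
    (a (x i) * b (y i) * a (x j) * b (y j) +
     b (x i) * a (y i) * b (x j) * a (y j)) =
  (\sum_(i < m) a (x i) * b (y i)) ^+ 2 + (\sum_(i < m) b (x i) * a (y i)) ^+ 2.
  rewrite !expr2 !mulr_suml -big_split; apply: eq_bigr => i _ /=.
  by rewrite !mulr_sumr -big_split; apply: eq_bigr => j _ /=; rewrite !mulrA.
by rewrite addr_ge0 ?sqr_ge0.
Qed.

Lemma CW_dual_elastic M : in_CW_dual M -> elastic_positivity M.
Proof.
move=> [hM pos] a b; have qM := in_W_quadrilinear _ hM.
have := pos _ (in_CW_square a b).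
rewrite pairingD !pairing_covectors // (in_W_flip _ a b a b hM).
by rewrite -mulr2n pmulrn_lge0.
Qed.

End Pairing.

(** * Orthogonal reflections and their action on the coordinate covectors *)

Section Reflections.
Context {R : realType} {V : vectType R} {n : nat} (e : n.-tuple V).
Hypothesis he : basis_of {:V} e.

(** For [u] of nonzero norm, the Householder reflection in the hyperplane orthogonal to [u]. *)
Definition reflection_mx (u : 'rV[R]_n) : 'M[R]_n :=
  1%:M - (2 / (u *m u^T) 0 0) *: (u^T *m u).

Lemma reflection_mx_orthogonal (u : 'rV[R]_n) :
  (u *m u^T) 0 0 != 0 -> orthogonal_mx (reflection_mx u).
Proof.
move=> u0; rewrite /orthogonal_mx /reflection_mx.
set q : R := (_ *m _) 0 0 in u0 *; set P := u^T *m u.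
have PT : P^T = P by rewrite trmx_mul trmxK.
(* With [c = 2 / q], the square of [1 - c P] is [1 - (2 c - c^2 q) P], and the bracket vanishes. *)
have PP : P *m P = q *: P.
  by rewrite mulmxA -(mulmxA u^T) [u *m u^T]mx11_scalar mul_mx_scalar -scalemxAl.
rewrite [(_ - _)^T]linearB /= [(_ *: P)^T]linearZ /= trmx1 PT mulmxBl mul1mx mulmxBr mulmx1.
rewrite -scalemxAl -scalemxAr PP !scalerA.
rewrite -scalerBl -addrA -opprD -scalerDl.
rewrite -[RHS]subr0 -(scale0r P); congr (_ - _ *: _).
by field.
Qed.
Lemma dual_coord_endo (A : 'M[R]_n) i :
  (dual_coord e i \o endo_of_mx e A)%VF = \sum_(j < n) A i j *: dual_coord e j.
Proof.
rewrite [LHS](dual_coord_sum _ _ _ he); apply: eq_bigr => j _; congr (_ *: _).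
rewrite comp_lfunE endo_of_mx_basis // dual_coordE linear_sum (bigD1 i) //=.
rewrite linearZ /= coord_free ?(basis_free he) // eqxx big1 ?addr0.
  by rewrite /GRing.scale /= mulr1.
move=> k nki; rewrite linearZ /= coord_free ?(basis_free he) //.
by rewrite (negPf nki) /GRing.scale /= mulr0.
Qed.

Lemma dual_coord_reflection (u : 'rV[R]_n) i :
  (dual_coord e i \o endo_of_mx e (reflection_mx u))%VF =
  dual_coord e i - (2 / (u *m u^T) 0 0 * u 0 i) *: \sum_(j < n) u 0 j *: dual_coord e j.
Proof.
rewrite dual_coord_endo scaler_sumr.
rewrite [X in X - _](_ : _ = \sum_(j < n) (i == j)%:R *: dual_coord e j); last first.
  rewrite (bigD1 i) //= eqxx scale1r big1 ?addr0 // => j nji.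
  by rewrite eq_sym (negPf nji) scale0r.
rewrite -sumrB; apply: eq_bigr => j _.
by rewrite scalerA -scalerBl !mxE big_ord1 !mxE mulrA.
Qed.

End Reflections.

(** * Coefficients of an invariant tensor; the elastic bounds as a sufficient condition *)

Section Invariant.
Context {R : realType} {V : vectType R} {n : nat} (e : n.-tuple V).
Hypothesis he : basis_of {:V} e.
Context (M : tensor4 (dual V)).
Hypothesis hM : in_Wdual_O e M.

Let m i j k l :=
  M (dual_coord e i) (dual_coord e j) (dual_coord e k) (dual_coord e l).

Let WM : in_W M := hM.1.
Let qM : quadrilinear M := in_W_quadrilinear _ WM.

Lemma invariant_reflection (u : 'rV[R]_n) i j k l : (u *m u^T) 0 0 != 0 ->
  let r i := dual_coord e i -
    (2 / (u *m u^T) 0 0 * u 0 i) *: \sum_(j < n) u 0 j *: dual_coord e j in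
  M (r i) (r j) (r k) (r l) = m i j k l.
Proof.
move=> u0 /=; rewrite -!(dual_coord_reflection _ he).
by rewrite -/(push _ M _ _ _ _) hM.2 //; apply: reflection_mx_orthogonal.
Qed.

(** The reflection along [e_p] negates the [p]-th coordinate covector and fixes the others, so it
    multiplies this coefficient by -1. *)
Lemma invariant_odd p i j k l :
  odd ((p == i) + (p == j) + (p == k) + (p == l)) -> m i j k l = 0.
Proof.
move=> podd; pose u : 'rV[R]_n := delta_mx 0 p.
have uu : (u *m u^T) 0 0 = 1 by rewrite trmx_delta mul_delta_mx mxE.
have su : \sum_(j < n) u 0 j *: dual_coord e j = dual_coord e p.
  rewrite (bigD1 p) //= big1 => [|q nqp]; rewrite mxE !eqxx ?scale1r ?addr0 //.
  by rewrite (negPf nqp) scale0r.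
have := invariant_reflection u i j k l; rewrite uu oner_neq0 su => /(_ isT) /=.
have E q : dual_coord e q - (2 / 1 * u 0 q) *: dual_coord e p =
    (-1) ^+ (p == q) *: dual_coord e q.
  rewrite mxE eqxx /= eq_sym; case: eqVneq => [->|_] /=.
    by rewrite -[X in X - _]scale1r -scalerBl; congr (_ *: _); field.
  by rewrite mulr0 scale0r subr0 scale1r.
rewrite !E quadrilinearZ // -!exprD -signr_odd podd -/(m i j k l) => h.
by lra.
Qed.

(* The reflection along [e_p - 2 e_q] sends [e_p] to [3/5 e_p + 4/5 e_q]. *)
Lemma invariant_345 p q : p != q ->
  625 * m p p p p =
  81 * m p p p p + 256 * m q q q q + 288 * (2 * m p p q q + m p q p q).
Proof.
move=> npq; pose u : 'rV[R]_n := delta_mx 0 p - 2 *: delta_mx 0 q.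
have up : u 0 p = 1 by rewrite !mxE !eqxx (negPf npq) /= mulr0 subr0.
have uq : u 0 q = - 2.
  by rewrite !mxE !eqxx eq_sym (negPf npq) /= mulr1 sub0r.
have u0 i : i != p -> i != q -> u 0 i = 0.
  by move=> /negPf ip /negPf iq; rewrite !mxE ip iq !andbF mulr0 subr0.
clearbody u.
(* The target is any module because both the squared norm of [u] and a combination of covectors are
   computed this way. *)
have sum_u (W : lmodType R) (f : 'I_n -> W) :
    \sum_(j < n) u 0 j *: f j = f p - 2 *: f q.
  rewrite (bigD1 p) //= (bigD1 q) 1?eq_sym //= up uq scale1r scaleNr.
  by rewrite big1 ?addr0 // => i /andP[ip iq]; rewrite u0 // scale0r.
have uu : (u *m u^T) 0 0 = 5.
  rewrite mxE (eq_bigr (fun j => u 0 j *: (u 0 j : R^o))).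
    by rewrite sum_u up uq /GRing.scale /=; ring.
  by move=> j _; rewrite [u^T _ _]mxE.
have := invariant_reflection u p p p p.
rewrite uu sum_u pnatr_eq0 => /(_ isT) /=; rewrite up.
rewrite (_ : _ - _ = (3/5) *: dual_coord e p + (4/5) *: dual_coord e q); last first.
  rewrite scalerBr opprB addrCA addrC scalerA.
  rewrite -[X in X - _]scale1r -scalerBl.
  by congr (_ *: _ + _ *: _); field.
have D f x y a b : scalar f -> f (x *: a + y *: b : dual V) = x * f a + y * f b.
  by move=> lf; rewrite lf (scalarZ _ _ _ lf).
case: qM => M1 M2 M3 M4.
rewrite (D _ _ _ _ _ (M1 _ _ _)) !(D _ _ _ _ _ (M2 _ _ _)).
rewrite !(D _ _ _ _ _ (M3 _ _ _)) !(D _ _ _ _ _ (M4 _ _ _)).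
rewrite -!/(m _ _ _ _).
(* Of the sixteen terms, those with one index occurring three times vanish by parity. The six
   balanced ones reduce to four copies of [m p p q q] and two of [m p q p q], each with weight 9 *
   16 = 144. *)
have Z i j : i != j ->
    [/\ m i j j j = 0, m j i j j = 0, m j j i j = 0 & m j j j i = 0].
  by move=> nij; split; apply: (invariant_odd i); rewrite eqxx (negPf nij).
have [-> -> -> ->] := Z p q npq.
have [-> -> -> ->] : [/\ m q p p p = 0, m p q p p = 0, m p p q p = 0 & m p p p q = 0].
  by apply: Z; rewrite eq_sym.
have -> : m q q p p = m p p q q by apply: in_W_exchange.
have -> : m p q q p = m p p q q by apply: in_W_tau.
have -> : m q p p q = m p p q q.
  by rewrite /m (in_W_exchange _ _ _ _ _ WM) (in_W_tau _ _ _ _ _ WM).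
have -> : m q p q p = m p q p q by apply: in_W_flip.
by lra.
Qed.

(** The mixed term of [invariant_345] is symmetric in [p] and [q]; subtracting the swapped identity
    leaves 800 times the difference equal to 0. *)
Lemma invariant_diag p q : m p p p p = m q q q q.
Proof.
have [->//|npq] := eqVneq p q.
have h1 := invariant_345 p q npq.
have h2 := invariant_345 q p; rewrite eq_sym in h2; have {}h2 := h2 npq.
have E1 : m q q p p = m p p q q by apply: in_W_exchange.
have E2 : m q p q p = m p q p q by apply: in_W_flip.
by rewrite E1 E2 in h2; lra.
Qed.

Lemma invariant_mixed p q : p != q ->
  m p p q q = (m p p p p - m p q p q) / 2.
Proof.
move=> npq; have := invariant_345 p q npq.
by rewrite -(invariant_diag p q); lra.
Qed.

(** By parity only the patterns iikk, ijji and ijij survive. When all four indices agree, the first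
    two terms cancel internally and the third gives the coefficient. *)
Lemma invariant_coef i j k l :
  m i j k l =
    (i == j)%:R * ((k == l)%:R * ((m i i i i - m i k i k) / 2)) +
    (j == k)%:R * ((i == l)%:R * ((m i i i i - m i j i j) / 2)) +
    (i == k)%:R * ((j == l)%:R * m i j i j).
Proof.
have [Ej|nij] := eqVneq i j.
  subst j.
  have [El|nkl] := eqVneq k l.
    subst l.
    have [Ek|nik] := eqVneq i k; first by subst k; rewrite /=; field.
    by rewrite invariant_mixed //=; field.
  have [Ek|nik] := eqVneq i k.
    subst k.
    have il : (i == l) = false by apply: negbTE.
    rewrite (invariant_odd l) ?il; first by rewrite /=; field.
    by rewrite eqxx eq_sym il.
  rewrite (invariant_odd k); first by rewrite /=; field.
  by rewrite eqxx eq_sym (negPf nik) (negPf nkl).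
have [Ek|njk] := eqVneq j k.
  subst k.
  have [El|nEil] := eqVneq i l.
    subst l.
    rewrite eq_sym (negPf nij).
    have -> : m i j j i = m i i j j by apply: in_W_tau.
    by rewrite invariant_mixed //=; field.
  rewrite (invariant_odd i); first by rewrite (negPf nij) /=; field.
  by rewrite eqxx (negPf nij) (negPf nEil).
have [Ek|nik] := eqVneq i k.
  subst k.
  have [El|njl] := eqVneq j l; first by subst l; rewrite /=; field.
  rewrite (invariant_odd j); first by rewrite /=; field.
  by rewrite eqxx eq_sym (negPf nij) (negPf njl).
have [El|njl] := eqVneq j l.
  subst l.
  rewrite (invariant_odd i); first by rewrite /=; field.
  by rewrite eqxx (negPf nij) (negPf nik).
rewrite (invariant_odd j); first by rewrite /=; field.
by rewrite eqxx eq_sym (negPf nij) (negPf njk) (negPf njl).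
Qed.

Lemma pairing_invariant S nu : in_W S -> (forall i, m i i i i = nu) ->
  pairing M S = nu * (\sum_(i < n) \sum_(j < n) S e`_i e`_i e`_j e`_j) +
    \sum_(i < n) \sum_(j < n)
      m i j i j * (S e`_i e`_j e`_i e`_j - S e`_i e`_j e`_j e`_i).
Proof.
move=> WS nuE; rewrite (pairingE he qM (in_W_quadrilinear _ WS)) /pairing_in.
have delta (i : 'I_n) (f : 'I_n -> R) : \sum_(j < n) (i == j)%:R * f j = f i.
  rewrite (bigD1 i) //= eqxx mul1r big1 ?addr0 // => j nji.
  by rewrite eq_sym (negPf nji) mul0r.
rewrite mulr_sumr -big_split; apply: eq_bigr => i _ /=.
transitivity (\sum_(j < n) (i == j)%:R *
    (\sum_(k < n) ((nu - m i k i k) / 2 * S e`_i e`_j e`_k e`_k)) +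
  \sum_(j < n) ((nu - m i j i j) / 2 * S e`_i e`_j e`_j e`_i +
     m i j i j * S e`_i e`_j e`_i e`_j)).
  rewrite -big_split; apply: eq_bigr => j _ /=; rewrite mulr_sumr.
  (* Kronecker deltas are inserted to bring both sides under the same fourfold sum. *)
  rewrite -(delta j (fun k => (nu - m i j i j) / 2 * S e`_i e`_j e`_k e`_i)).
  rewrite -(delta i (fun k => m i j i j * S e`_i e`_j e`_k e`_j)).
  rewrite -!big_split; apply: eq_bigr => k _ /=.
  rewrite -(delta k (fun l => (nu - m i k i k) / 2 * S e`_i e`_j e`_k e`_l)).
  rewrite -(delta i (fun l => (nu - m i j i j) / 2 * S e`_i e`_j e`_k e`_l)).
  rewrite -(delta j (fun l => m i j i j * S e`_i e`_j e`_k e`_l)).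
  rewrite !mulr_sumr -!big_split; apply: eq_bigr => l _ /=.
  by rewrite -/(m i j k l) invariant_coef nuE; ring.
rewrite delta mulr_sumr -!big_split; apply: eq_bigr => j _ /=.
(* The [tau] symmetry identifies the iijj and ijji values of [S], so the two halves of [nu]
   combine. *)
by rewrite (in_W_tau _ _ _ _ _ WS); field.
Qed.

Lemma elastic_CW_dual : elastic_positivity M -> in_CW_dual M.
Proof.
move=> el; split=> // S [WS pS]; have qS := in_W_quadrilinear _ WS.
have [nu nu0 nuE] : exists2 nu, 0 <= nu & forall i, m i i i i = nu.
  (* If the basis is empty there is no diagonal coefficient, and [nu] is taken to be 0. *)
  case: (pickP (predT : pred 'I_n)) => [i0 _|none].
    by exists (m i0 i0 i0 i0) => [|i]; [apply: el | apply: invariant_diag].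
  by exists 0 => // i; have := none i.
rewrite (pairing_invariant _ _ WS nuE); apply: addr_ge0.
  by rewrite mulr_ge0 // (pS n (fun i => e`_i) (fun i => e`_i)).
(* Adding [T] to itself with the indices exchanged completes each summand to [m i j i j] times the
   value of [S] on the antisymmetrised pair [w_ij]. *)
set T := \sum_(i < n) _; suff : 0 <= T + T by lra.
rewrite {2}/T exchange_big -big_split; apply: sumr_ge0 => i _ /=.
rewrite -big_split; apply: sumr_ge0 => j _ /=.
have -> : m j i j i = m i j i j by apply: in_W_flip.
rewrite -mulrDr mulr_ge0 //; first exact: el.
have := psd_antisym S e`_i e`_j qS pS; lra.
Qed.

End Invariant.

Theorem theorem5p3 (R : realType) (V : vectType R) (hV : \dim {:V} = 3%N)
    (e : 3.-tuple V) (he : basis_of {:V} e)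
    (M : tensor4 (dual V)) (hM : in_Wdual_O e M) :
  in_CW_dual M <-> elastic_positivity M.
Proof.
by split=> [/CW_dual_elastic|]; last exact: (elastic_CW_dual e).
Qed.
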